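(* Let $X$ and $Y$ be Banach spaces, and let $A:D(A)\subset X\to X$ and $B:D(B)\subset Y\to Y$ be similar and non-negative linear operators, with $T:X\to Y$ the isometric isomorphism such that $B=TAT^{-1}$. If $\alpha\in\mathbb C$ satisfies $\operatorname{Re}\alpha>0$, then $$J_B^\alpha=TJ_A^\alpha T^{-1}$$ and $$B^\alpha=TA^\alpha T^{-1}.$$
   Context: $A$ and $B$ are similar if there is an isometric isomorphism $T:X\to Y$ such that $B=TAT^{-1}$, with domain $D(B)=\{x\in Y:T^{-1}x\in D(A)\}$. Equalities of operators include equality of domains (natural domains for compositions). A linear operator $A:D(A)\subset X\to X$ on a Banach space is non-negative if for every $\lambda>0$ the operator $\lambda+A:D(A)\to X$ is bijective with bounded inverse, and $\sup_{\lambda>0}\|\lambda(\lambda+A)^{-1}\|<\infty$. For a non-negative operator $A$, $\operatorname{Re}\alpha>0$ and an integer $n>\operatorname{Re}\alpha$, the Balakrishnan operator $J_A^\alpha$ is given, for $\phi\in D(A^n)$, by the Bochner integral $$J_A^\alpha\phi=\frac{\Gamma(n)}{\Gamma(\alpha)\Gamma(n-\alpha)}\int_0^\infty\lambda^{\alpha-1}[A(\lambda+A)^{-1}]^n\phi\,d\lambda,$$ with domain $D(J_A^\alpha)=D(A^n)$ (the same $n$ is used for $A$ and $B$). The fractional power is $$A^\alpha=(A+\lambda)^nJ_A^\alpha(A+\lambda)^{-n},\qquad \lambda\in\rho(-A),$$ with $\rho(-A)$ the resolvent set of $-A$ (the definition does not depend on the choice of $\lambda$ or $n$). If $A$ is bounded,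 $A^\alpha=J_A^\alpha$. *)

(* Defs.v *)
From HB Require Import structures.
From mathcomp Require Import all_boot all_order all_algebra.
From mathcomp Require Import all_classical all_reals all_analysis.
From mathcomp Require Import complex.
Set Implicit Arguments.
Unset Strict Implicit.
Unset Printing Implicit Defensive.
Import Order.TTheory GRing.Theory Num.Theory.
Import numFieldNormedType.Exports.
Local Open Scope classical_set_scope.
Local Open Scope ring_scope.
Local Open Scope complex_scope.

(* A partially defined map: the values of [opfun] outside [dom] are junk and
   are ignored by [opeq]. *)
Record operator (X Y : Type) := Operator { dom : set X; opfun :> X -> Y }.

Definition opeq (X Y : Type) (S S' : operator X Y) : Prop :=
  dom S = dom S' /\ (forall x, dom S x -> S x = S' x).

Notation "S =op S'" := (opeq S S') (at level 70, no associativity).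

Definition op_total (X Y : Type) (f : X -> Y) : operator X Y :=
  Operator setT f.

Definition op_comp (X Y Z : Type) (S : operator Y Z) (S' : operator X Y) :
    operator X Z :=
  Operator [set x | dom S' x /\ dom S (S' x)] (fun x => S (S' x)).

Fixpoint op_pow (X : Type) (S : operator X X) (n : nat) : operator X X :=
  if n is m.+1 then op_comp S (op_pow S m) else op_total id.

Section Operators.
Context {R : realType}.
Implicit Types X Y : normedModType R[i].

(* The inverse has domain the range of S; it is meaningful when S is injective
   on its domain. *)
Definition op_inv X Y (S : operator X Y) :
    operator Y X :=
  Operator (S @` dom S) (fun y => xget 0 [set x | dom S x /\ S x = y]).

Definition op_opp X (A : operator X X) : operator X X :=
  Operator (dom A) (fun x => - A x).

Definition op_scale X Y (z : R[i]) (A : operator X Y) : operator X Y :=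
  Operator (dom A) (fun x => z *: A x).

(* z + A *)
Definition op_shift X (z : R[i]) (A : operator X X) : operator X X :=
  Operator (dom A) (fun x => z *: x + A x).

Definition linear_operator X Y (A : operator X Y) : Prop :=
  dom A 0 /\
  forall (z : R[i]) (x y : X), dom A x -> dom A y ->
    dom A (z *: x + y) /\ A (z *: x + y) = z *: A x + A y.

(* The norm of X takes values in R[i], on the nonnegative real axis. *)
Definition rnorm X (x : X) : R := complex.Re `|x|.

Definition opnorm X Y (S : operator X Y) : \bar R :=
  ereal_sup [set (rnorm (S x))%:E | x in [set x | dom S x /\ rnorm x <= 1]].

Definition boundedly_invertible X (S : operator X X) : Prop :=
  set_bij (dom S) setT S /\ (opnorm (op_inv S) < +oo)%E.

(* All z such that z - A is boundedly invertible. *)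
Definition resolvent_set X (A : operator X X) : set R[i] :=
  [set z | boundedly_invertible (op_shift z (op_opp A))].

Definition nonnegative_operator X (A : operator X X) : Prop :=
  (forall l : R, 0 < l -> boundedly_invertible (op_shift l%:C A)) /\
  (ereal_sup [set opnorm (op_scale l%:C (op_inv (op_shift l%:C A)))
             | l in [set l : R | (0 < l)%R]] < +oo)%E.

Definition isometric_isomorphism X Y (T : X -> Y) : Prop :=
  [/\ linear T, bijective T & forall x, rnorm (T x) = rnorm x].

(* T A T^-1, with the natural domain *)
Definition op_conj X Y (T : X -> Y) (A : operator X X) : operator Y Y :=
  op_comp (op_total T) (op_comp A (op_inv (op_total T))).

Definition similar_via X Y (T : X -> Y) (A : operator X X)
    (B : operator Y Y) : Prop :=
  isometric_isomorphism T /\ B =op op_conj T A.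

End Operators.

Section Bochner.
Context {R : realType} {d : measure_display} {U : measurableType d}.
Context {X : normedModType R[i]}.
Variables (mu : {measure set U -> \bar R}) (D : set U).

Definition integrable_simple (s : U -> X) : Prop :=
  finite_set (s @` D) /\
  forall y, measurable (D `&` s @^-1` [set y]) /\
    (y != 0 -> (mu (D `&` s @^-1` [set y]) < +oo)%E).

(* If the level set of y = 0 has infinite measure, its term is still 0. *)
Definition simple_integral (s : U -> X) : X :=
  \sum_(y \in s @` D) (fine (mu (D `&` s @^-1` [set y])))%:C *: y.

Definition is_bochner (f : U -> X) (v : X) : Prop :=
  exists s : nat -> U -> X,
    [/\ forall n, integrable_simple (s n),
        forall t, D t -> (fun n => s n t) @ \oo --> f t,
        (fun n => (\int[mu]_(t in D) (rnorm (f t - s n t))%:E)%E) @ \oo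
          --> 0%E
      & (fun n => simple_integral (s n)) @ \oo --> v].

(* The value is 0 by convention if f is not Bochner integrable on D. *)
Definition bochner (f : U -> X) : X := xget 0 [set v | is_bochner f v].

End Bochner.

Section FractionalPowers.
Context {R : realType}.

(* t ^ z = exp (z ln t) for t > 0 *)
Definition cpow (t : R) (z : R[i]) : R[i] :=
  (t `^ complex.Re z * cos (complex.Im z * ln t)) +i*
  (t `^ complex.Re z * sin (complex.Im z * ln t)).

(* Euler's integral for the Gamma function, meaningful for Re z > 0 *)
Definition Gamma (z : R[i]) : R[i] :=
  (\int[lebesgue_measure]_(t in `]0%R, +oo[)
     (complex.Re (cpow t (z - 1)) * expR (- t))) +i*
  (\int[lebesgue_measure]_(t in `]0%R, +oo[)
     (complex.Im (cpow t (z - 1)) * expR (- t))).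

Definition balakrishnan (X : normedModType R[i]) (A : operator X X)
    (a : R[i]) (n : nat) : operator X X :=
  Operator (dom (op_pow A n))
    (fun phi =>
       (Gamma n%:R / (Gamma a * Gamma (n%:R - a))) *:
       bochner lebesgue_measure `]0%R, +oo[
         (fun l : R => cpow l (a - 1) *:
            op_pow (op_comp A (op_inv (op_shift l%:C A))) n phi)).

(* (A + z)^n J_A^a (A + z)^-n; the fractional power A^a is this operator, for
   any n > Re a and any z in the resolvent set of -A. *)
Definition frac_power (X : normedModType R[i]) (A : operator X X)
    (a : R[i]) (n : nat) (z : R[i]) : operator X X :=
  op_comp (op_pow (op_shift z A) n)
    (op_comp (balakrishnan A a n) (op_pow (op_inv (op_shift z A)) n)).

End FractionalPowers.

(* Main.v *)
Require Import Defs.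
From HB Require Import structures.
From mathcomp Require Import all_boot all_order all_algebra.
From mathcomp Require Import all_classical all_reals all_analysis.
From mathcomp Require Import measurable_realfun complex.
Import Order.TTheory GRing.Theory Num.Theory.
Import numFieldNormedType.Exports.
Local Open Scope classical_set_scope.
Local Open Scope ring_scope.
Local Open Scope complex_scope.
Set Implicit Arguments.
Unset Strict Implicit.
Unset Printing Implicit Defensive.

(** The Balakrishnan operator and the fractional powers are built from A by
    composing, inverting, shifting and integrating. All of these
    constructions are natural: if T carries A to B (predicate [intertwines]),
    then it carries each operator built from A to the one built from B. Most of
    them only need T to be a linear bijection; the integral needs in addition
    that T and its inverse are bounded, so that Bochner integrals pass through T
    ([bochner_isomorphism]). This gives J_B = T J_A T^-1
    ([balakrishnan_intertwines]) and B^alpha = T A^alpha T^-1 when the same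
    shift is used on both sides ([frac_power_intertwines]).

    The two sides of the second equality may use different shifts z and w, so
    it also has to be shown that (A + z)^n J (A + z)^-n does not depend on z
    ([frac_power_shift_indep]). This is again an instance of naturality. The
    map E = (A + w)(A + z)^-1 is a bounded bijection of X with bounded inverse
    (A + z)(A + w)^-1, and it intertwines A with itself; therefore so does
    E^n, and E^n commutes with J. Since (A + z) E = A + w and
    (A + w)^-1 E = (A + z)^-1,
    (A + z)^n J (A + z)^-n = (A + z)^n J E^n (A + w)^-n
    = (A + z)^n E^n J (A + w)^-n = (A + w)^n J (A + w)^-n.

    The Bochner integral is defined by choosing a value, so passing it through
    an isomorphism rests on the uniqueness of that value
    ([is_bochner_unique]): two approximating sequences of simple functions are
    compared through the bound of the norm of a difference of simple integrals
    by the integral of the norm ([rnorm_simple_integralB]). *)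

(** * Linear maps and the real-valued norm *)

Lemma linear_fun0 (K : pzRingType) (V W : lmodType K) (f : V -> W) :
  linear f -> f 0 = 0.
Proof.
by move=> lf; have := lf (-1) 0 0; rewrite scaler0 addr0 scaleN1r addNr.
Qed.

Lemma linear_funZ (K : pzRingType) (V W : lmodType K) (f : V -> W) a x :
  linear f -> f (a *: x) = a *: f x.
Proof. by move=> lf; rewrite -[a *: x]addr0 lf linear_fun0// addr0. Qed.

Lemma linear_funD (K : pzRingType) (V W : lmodType K) (f : V -> W) x y :
  linear f -> f (x + y) = f x + f y.
Proof. by move=> lf; rewrite -[x]scale1r lf !scale1r. Qed.

Lemma linear_funB (K : pzRingType) (V W : lmodType K) (f : V -> W) x y :
  linear f -> f (x - y) = f x - f y.
Proof. by move=> lf; rewrite -[- y]scaleN1r addrC lf scaleN1r addrC. Qed.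

(** The norm takes values in the complex numbers, but is real, so that its real
    part loses nothing. *)
Lemma rnormE (R : realType) (X : normedModType R[i]) (x : X) :
  (rnorm x)%:C = `|x|.
Proof.
have := normr_ge0 x; rewrite lecE /rnorm; case: `|x| => a b /=.
by move=> /andP[/eqP -> _].
Qed.

Lemma rnorm_ge0 (R : realType) (X : normedModType R[i]) (x : X) : 0 <= rnorm x.
Proof. by rewrite -lecR rnormE; exact: normr_ge0. Qed.

Lemma rnorm0 (R : realType) (X : normedModType R[i]) : rnorm (0 : X) = 0.
Proof. by rewrite /rnorm normr0. Qed.

Lemma rnorm_eq0 (R : realType) (X : normedModType R[i]) (x : X) :
  rnorm x = 0 -> x = 0.
Proof. by move=> x0; apply/normr0_eq0; rewrite -rnormE x0. Qed.

Lemma rnormN (R : realType) (X : normedModType R[i]) (x : X) :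
  rnorm (- x) = rnorm x.
Proof. by rewrite /rnorm normrN. Qed.

Lemma rnormD (R : realType) (X : normedModType R[i]) (x y : X) :
  rnorm (x + y) <= rnorm x + rnorm y.
Proof. by rewrite -lecR rmorphD /= !rnormE ler_normD. Qed.

Lemma rnormZ (R : realType) (X : normedModType R[i]) (a : R[i]) (x : X) :
  rnorm (a *: x) = complex.Re `|a| * rnorm x.
Proof.
by apply: complexI; rewrite rmorphM /= !rnormE normrZ.
Qed.

Lemma rnormZr (R : realType) (X : normedModType R[i]) (a : R) (x : X) :
  0 <= a -> rnorm (a%:C *: x) = a * rnorm x.
Proof.
by move=> a0; rewrite rnormZ normc_def/= expr0n/= addr0 sqrtr_sqr ger0_norm.
Qed.

(** Convergence is defined by neighbourhoods whose radii are positive complex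
    numbers; these are exactly the positive reals. *)
Lemma cvg_rnorm (R : realType) (X : normedModType R[i]) (u : nat -> X) (l : X) :
  u @ \oo --> l <-> (fun n => rnorm (l - u n)) @ \oo --> (0 : R).
Proof.
split.
  move=> /cvgrPdist_lt ul; apply/cvgr0Pnorm_lt => e e0.
  have := ul e%:C; rewrite ltcR => /(_ e0); apply: filterS => n.
  by rewrite -rnormE ltcR ger0_norm ?rnorm_ge0.
move=> /cvgr0Pnorm_lt ul; apply/cvgrPdist_lt => e.
rewrite ltcE => /andP[/eqP /= ei e0].
have := ul (complex.Re e) e0; apply: filterS => n.
by rewrite -rnormE ger0_norm ?rnorm_ge0// ltcE /= ei eqxx.
Qed.

(** * Intertwined operators *)

(** Isometries are not enough: the maps (A + w)(A + z)^-1 that change the shift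
    are only bicontinuous. *)
Definition top_isomorphism (R : realType) (X Y : normedModType R[i])
    (T : X -> Y) (S : Y -> X) : Prop :=
  [/\ linear T, cancel T S, cancel S T,
      exists c, forall x, rnorm (T x) <= c * rnorm x &
      exists c, forall y, rnorm (S y) <= c * rnorm y].

Lemma top_isomorphism_sym (R : realType) (X Y : normedModType R[i])
    (T : X -> Y) (S : Y -> X) :
  top_isomorphism T S -> top_isomorphism S T.
Proof.
move=> [lT TS ST Tb Sb]; split => // a x y.
by apply: (can_inj TS); rewrite ST lT !ST.
Qed.

Lemma top_isomorphism_id (R : realType) (X : normedModType R[i]) :
  @top_isomorphism R X X id id.
Proof. by split => //; exists 1 => x; rewrite mul1r. Qed.

Lemma top_isomorphism_comp (R : realType) (X Y Z : normedModType R[i])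
    (T : X -> Y) (S : Y -> X) (T' : Y -> Z) (S' : Z -> Y) :
  top_isomorphism T S -> top_isomorphism T' S' ->
  top_isomorphism (T' \o T) (S \o S').
Proof.
have bdd (V1 V2 V3 : normedModType R[i]) (f : V1 -> V2) (g : V2 -> V3) :
    (exists c, forall x, rnorm (f x) <= c * rnorm x) ->
    (exists c, forall x, rnorm (g x) <= c * rnorm x) ->
    exists c, forall x, rnorm ((g \o f) x) <= c * rnorm x.
  move=> [c fc] [c' gc]; exists (`|c'| * c) => x /=.
  apply: (le_trans (gc _)); rewrite -mulrA.
  apply: (@le_trans _ _ (`|c'| * rnorm (f x))).
    by rewrite ler_wpM2r ?rnorm_ge0 ?ler_norm.
  by rewrite ler_wpM2l.
move=> [lT TS ST Tb Sb] [lT' TS' ST' Tb' Sb']; split.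
- by move=> a x y /=; rewrite lT lT'.
- by move=> x /=; rewrite TS' TS.
- by move=> x /=; rewrite ST ST'.
- exact: bdd.
- exact: bdd.
Qed.

Lemma top_isomorphism_iter (R : realType) (X : normedModType R[i])
    (T S : X -> X) (n : nat) :
  top_isomorphism T S ->
  exists S', top_isomorphism (iter n T) S'.
Proof.
move=> TS; elim: n => [|n [S' IH]].
  by exists id; exact: top_isomorphism_id.
by exists (S' \o S); exact: top_isomorphism_comp IH TS.
Qed.

(** B T = T A with domains, required pointwise on X so that the junk values of A
    and B outside their domains do not matter. When A and B are the same operator,
    this says that T commutes with it. *)
Definition intertwines (X Y : Type) (T : X -> Y)
    (A : operator X X) (B : operator Y Y) : Prop :=
  forall x, (dom A x <-> dom B (T x)) /\ (dom A x -> B (T x) = T (A x)).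

Lemma intertwines_comp (X Y : Type) (T : X -> Y) (A A' : operator X X)
    (B B' : operator Y Y) :
  intertwines T A B -> intertwines T A' B' ->
  intertwines T (op_comp A A') (op_comp B B').
Proof.
move=> AB A'B' x; have [dx vx] := A'B' x; have [dy vy] := AB (A' x).
split=> /=; last by move=> [ax aax]; rewrite vx// vy.
split=> [[ax aax]|[bx bbx]].
  by rewrite vx//; split; [apply/dx|apply/dy].
by move/dx : (bx) => ax; split => //; apply/dy; rewrite -vx.
Qed.

Lemma intertwines_pow (X Y : Type) (T : X -> Y) (A : operator X X)
    (B : operator Y Y) (n : nat) :
  intertwines T A B -> intertwines T (op_pow A n) (op_pow B n).
Proof.
by move=> AB; elim: n => [//|n IH]; exact: intertwines_comp.
Qed.

Lemma intertwines_shift (R : realType) (X Y : normedModType R[i]) (T : X -> Y)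
    (A : operator X X) (B : operator Y Y) (z : R[i]) :
  linear T -> intertwines T A B ->
  intertwines T (op_shift z A) (op_shift z B).
Proof.
move=> lT AB x; have [dx vx] := AB x; split => //= ax.
by rewrite vx// lT.
Qed.

Lemma op_invK (R : realType) (X Y : normedModType R[i]) (S : operator X Y) x :
  set_inj (dom S) S -> dom S x -> op_inv S (S x) = x.
Proof.
move=> Sinj Sx; apply: xget_unique => //= y [Sy yx].
by apply: Sinj => //; rewrite inE.
Qed.

(** Injectivity is needed to pin down the chosen preimages; B inherits it from
    A through T. *)
Lemma intertwines_inv (R : realType) (X Y : normedModType R[i])
    (T : X -> Y) (A : operator X X) (B : operator Y Y) :
  bijective T -> set_inj (dom A) A -> intertwines T A B ->
  intertwines T (op_inv A) (op_inv B).
Proof.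
move=> [S TS ST] Ainj AB.
have Binj : set_inj (dom B) B.
  move=> y y'; rewrite !inE -(ST y) -(ST y').
  move=> /(AB _).1 ay /(AB _).1 ay'; rewrite (AB _).2// (AB _).2//.
  by move=> /(can_inj TS) /Ainj ->//; rewrite inE.
move=> x; split.
  split=> [[y ay <-]|[y By yx]].
    by exists (T y); [exact/(AB y).1|rewrite (AB y).2].
  move: By yx; rewrite -(ST y) => /(AB _).1 ay; rewrite (AB _).2//.
  by move=> /(can_inj TS) <-; exists (S y).
move=> [y ay <-]; rewrite -(AB _).2// !op_invK//.
exact/(AB y).1.
Qed.

(** This turns equality with the conjugate, natural domains included, into the
    relation that is stable under all the constructions. *)
Lemma intertwines_opeq_conj (R : realType) (X Y : normedModType R[i])
    (T : X -> Y) (A : operator X X) (B : operator Y Y) :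
  bijective T -> intertwines T A B <-> B =op op_conj T A.
Proof.
move=> bT; have [S TS ST] := bT.
have invT y : op_inv (op_total T) y = S y.
  by rewrite -{1}(ST y) (@op_invK _ _ _ (op_total T))// => u v _ _ /(can_inj TS).
have domE y : dom (op_conj T A) y <-> dom A (S y).
  rewrite -invT; split=> [[[]]//|Ay]; split => //; split => //.
  by exists (S y).
have valE y : op_conj T A y = T (A (S y)) by rewrite -invT.
split=> [AB|[dE vE] x].
  split.
    apply/seteqP; split => y.
      by rewrite -{1}(ST y) => By; apply/domE/(AB _).1.
    by move=> /domE Ay; rewrite -(ST y); apply/(AB _).1.
  move=> y; rewrite -{1}(ST y) => /(AB _).1 Ay.
  by rewrite valE -(AB _).2 // ST.
have dx : dom A x <-> dom B (T x) by rewrite dE -{1}(TS x) -domE.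
by split => // /dx; move=> /vE ->; rewrite valE TS.
Qed.

(** An isometry maps the unit ball of X into that of Y, so the supremum defining
    the norm of the inverse of A runs over a subset of that of B. *)
Lemma intertwines_boundedly_invertible (R : realType) (X Y : normedModType R[i])
    (T : X -> Y) (A : operator X X) (B : operator Y Y) :
  isometric_isomorphism T -> intertwines T A B ->
  boundedly_invertible B -> boundedly_invertible A.
Proof.
move=> [lT bT isoT] AB [[_ Binj Bsurj] Bbdd]; have [S TS ST] := bT.
have Ainj : set_inj (dom A) A.
  move=> x x'; rewrite !inE => ax ax' /(congr1 T).
  rewrite -!(AB _).2// => /Binj; rewrite !inE => /(_ _ _)/(can_inj TS).
  by apply; apply/(AB _).1.
split.
  split => // x _; have [y By yx] := Bsurj (T x) Logic.I.
  move: By yx; rewrite -(ST y) => /(AB _).1 ay; rewrite (AB _).2//.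
  by move=> /(can_inj TS) <-; exists (S y).
apply: le_lt_trans Bbdd; apply: le_ereal_sup => _ [x [dx x1] <-].
have inv := intertwines_inv bT Ainj AB x.
exists (T x); last by rewrite inv.2// isoT.
by split; [exact/inv.1|rewrite isoT].
Qed.

(** * Resolvents and change of shift *)

Lemma linear_operatorD (R : realType) (X : normedModType R[i])
    (A : operator X X) : linear_operator A ->
  forall x y, dom A x -> dom A y -> dom A (x + y) /\ A (x + y) = A x + A y.
Proof.
by move=> [_ lA] x y dx dy; have := lA 1 x y dx dy; rewrite !scale1r.
Qed.

Lemma linear_operatorZ (R : realType) (X : normedModType R[i])
    (A : operator X X) : linear_operator A ->
  forall z x, dom A x -> dom A (z *: x) /\ A (z *: x) = z *: A x.
Proof.
move=> lA z x dx; have [d0 lA'] := lA; have := lA' z x 0 dx d0.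
have [_] := linear_operatorD lA d0 d0; rewrite addr0 => /esym/(canRL (addrK _)).
by rewrite subrr => ->; rewrite !addr0.
Qed.

(** The operator norm is a supremum over the unit ball; homogeneity extends the
    bound to the whole space. *)
Lemma opnorm_bound (R : realType) (X Y : normedModType R[i]) (f : X -> Y)
    (S : operator X Y) :
  linear f -> dom S = setT -> f =1 S -> (opnorm S < +oo)%E ->
  exists c, forall x, rnorm (f x) <= c * rnorm x.
Proof.
move=> lf domS fS normS.
have f0 := linear_fun0 lf.
have [c unit_ball] : exists c, forall x, rnorm x <= 1 -> rnorm (f x) <= c.
  have ub x : rnorm x <= 1 -> ((rnorm (f x))%:E <= opnorm S)%E.
    by move=> x1; apply: ereal_sup_ubound; exists x; rewrite ?fS// domS.
  case: (opnorm S) normS ub => [c _|//|_] ub; last first.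
    by have := ub 0; rewrite rnorm0 ler01 => /(_ isT).
  by exists c => x x1; rewrite -lee_fin; exact: ub.
exists c => x; have [x0|/eqP x0] := eqVneq (rnorm x) 0.
  by rewrite (rnorm_eq0 x0) f0 !rnorm0 mulr0.
have x_gt0 : 0 < rnorm x by rewrite lt_neqAle rnorm_ge0 eq_sym andbT; apply/eqP.
have := unit_ball ((rnorm x)^-1%:C *: x).
rewrite linear_funZ// !rnormZr ?invr_ge0 ?rnorm_ge0// mulVf ?gt_eqF//.
move=> /(_ (lexx _)).
by rewrite ler_pdivrMl// mulrC.
Qed.

Lemma resolventP (R : realType) (X : normedModType R[i]) (A : operator X X)
    (z : R[i]) (G := op_inv (op_shift z A)) :
  linear_operator A -> boundedly_invertible (op_shift z A) ->
  [/\ forall x, dom A (G x),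
      forall x, z *: G x + A (G x) = x,
      forall x, dom A x -> G (z *: x + A x) = x,
      linear G &
      exists c, forall x, rnorm (G x) <= c * rnorm x].
Proof.
move=> lA [[_ zAinj zAsurj] Gbdd].
have GK x : dom A x -> G (z *: x + A x) = x.
  by move=> dx; exact: (@op_invK _ _ _ (op_shift z A)).
have dG x : dom A (G x).
  by have [y dy <-] := zAsurj x Logic.I; rewrite GK.
have KG x : z *: G x + A (G x) = x.
  by have [y dy <-] := zAsurj x Logic.I; rewrite GK.
have linG : linear G.
  move=> a x y; rewrite -{1}(KG x) -{1}(KG y).
  have [daG aG] := linear_operatorZ lA a (dG x).
  have [dG' aG'] := linear_operatorD lA daG (dG y).
  rewrite -[RHS]GK// aG' aG scalerDr scalerDr !scalerA [a * z]mulrC.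
  by rewrite addrACA.
split => //; apply: (opnorm_bound linG _ _ Gbdd) => //.
exact/seteqP.
Qed.

(** The map (A + w)(A + z)^-1, written in the form in which linearity and
    boundedness are visible. *)
Definition shift_change (R : realType) (X : normedModType R[i])
    (A : operator X X) (z w : R[i]) (x : X) : X :=
  x + (w - z) *: op_inv (op_shift z A) x.

Lemma shift_changeE (R : realType) (X : normedModType R[i])
    (A : operator X X) (z w : R[i]) (x : X) :
  linear_operator A -> boundedly_invertible (op_shift z A) ->
  shift_change A z w x = op_shift w A (op_inv (op_shift z A) x).
Proof.
move=> lA bA; have [_ KG _ _ _] := resolventP lA bA.
by rewrite /shift_change -{1}(KG x) scalerBl addrC /= addrA subrK.
Qed.

(** It suffices that the resolvent G maps into the domain of A and commutes with
    A on that domain. *)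
Lemma shift_change_intertwines (R : realType) (X : normedModType R[i])
    (A : operator X X) (z w : R[i]) :
  linear_operator A -> boundedly_invertible (op_shift z A) ->
  intertwines (shift_change A z w) A A.
Proof.
move=> lA bA; have [dG KG GK _ _] := resolventP lA bA.
set G : X -> X := op_inv _ in dG KG GK *.
move=> x; rewrite /shift_change -/G.
have [dwG wG] := linear_operatorZ lA (w - z) (dG x).
split.
  split=> dx; first exact: (linear_operatorD lA dx dwG).1.
  have [dNwG _] := linear_operatorZ lA (-1) dwG.
  by have [] := linear_operatorD lA dx dNwG; rewrite scaleN1r addrK.
move=> dx; rewrite (linear_operatorD lA dx dwG).2 wG.
congr (_ + _ *: _).
(* A G = G A on the domain of A, since A G x = x - z G x stays in it *)
have AG : A (G x) = x - z *: G x by rewrite -{2}(KG x) addrC addKr.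
have dAG : dom A (A (G x)).
  have [dzG _] := linear_operatorZ lA (- z) (dG x).
  by rewrite AG -scaleNr; exact: (linear_operatorD lA dx dzG).1.
have [dzG zG] := linear_operatorZ lA z (dG x).
rewrite -[LHS]GK// -zG -(linear_operatorD lA dzG dAG).2.
by rewrite KG.
Qed.

(** Here (A + w)^-1 (A + w) cancels, which expresses the resolvent at z
    through the resolvent at w. *)
Lemma op_inv_shift_change (R : realType) (X : normedModType R[i])
    (A : operator X X) (z w : R[i]) (x : X) :
  linear_operator A -> boundedly_invertible (op_shift z A) ->
  boundedly_invertible (op_shift w A) ->
  op_inv (op_shift w A) (shift_change A z w x) = op_inv (op_shift z A) x.
Proof.
move=> lA zA wA; rewrite shift_changeE//.
have [_ _ GK _ _] := resolventP lA wA; apply: GK.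
by have [dG _ _ _ _] := resolventP lA zA; exact: dG.
Qed.

Lemma shift_changeK (R : realType) (X : normedModType R[i])
    (A : operator X X) (z w : R[i]) :
  linear_operator A -> boundedly_invertible (op_shift z A) ->
  boundedly_invertible (op_shift w A) ->
  cancel (shift_change A z w) (shift_change A w z).
Proof.
move=> lA zA wA x; rewrite shift_changeE// op_inv_shift_change//.
by have [_ KG _ _ _] := resolventP lA zA; exact: KG.
Qed.

Lemma op_shift_shift_change (R : realType) (X : normedModType R[i])
    (A : operator X X) (z w : R[i]) (x : X) :
  linear_operator A -> boundedly_invertible (op_shift z A) -> dom A x ->
  op_shift z A (shift_change A z w x) = op_shift w A x.
Proof.
move=> lA zA dx; have [dG KG GK linG _] := resolventP lA zA.
have [_ sA] := shift_change_intertwines w lA zA x.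
rewrite /= sA// /shift_change scalerDr addrACA !scalerA mulrC -scalerA.
rewrite -scalerDr -linG GK//.
by rewrite scalerBl addrC addrA subrK.
Qed.

Lemma shift_change_isomorphism (R : realType) (X : normedModType R[i])
    (A : operator X X) (z w : R[i]) :
  linear_operator A -> boundedly_invertible (op_shift z A) ->
  boundedly_invertible (op_shift w A) ->
  top_isomorphism (shift_change A z w) (shift_change A w z).
Proof.
move=> lA zA wA.
have bdd u v : boundedly_invertible (op_shift u A) ->
    exists c, forall x, rnorm (shift_change A u v x) <= c * rnorm x.
  move=> uA; have [_ _ _ _ [c Gc]] := resolventP lA uA.
  exists (1 + complex.Re `|v - u| * c) => x.
  rewrite mulrDl mul1r (le_trans (rnormD _ _))// lerD2l rnormZ -mulrA.
  rewrite ler_wpM2l//.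
  by rewrite -[X in X <= _]/(complex.Re 0) -lecR RRe_real ?normr_real ?normr_ge0.
split; [|exact: shift_changeK|exact: shift_changeK|exact: bdd|exact: bdd].
have [_ _ _ linG _] := resolventP lA zA.
move=> a x y; rewrite /shift_change linG scalerDr !scalerA [_ * a]mulrC.
by rewrite -scalerA addrACA -scalerDr.
Qed.

(** If E commutes with S and S' = S E, then S'^n = S^n E^n. It is used both for
    A + z and A + w and for their inverses. *)
Lemma op_pow_translate (X : Type) (E : X -> X) (S S' : operator X X) (n : nat) :
  intertwines E S S ->
  (forall x, dom S' x <-> dom S (E x)) ->
  (forall x, dom S' x -> S' x = S (E x)) ->
  forall x, (dom (op_pow S' n) x <-> dom (op_pow S n) (iter n E x)) /\
    (dom (op_pow S' n) x -> op_pow S' n x = op_pow S n (iter n E x)).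
Proof.
move=> ES dS' vS'; elim: n => [//|n IH] x; have [dn vn] := IH x.
have [dE vE] := intertwines_pow n ES (iter n E x).
split=> /=; last by move=> [dx d'x]; rewrite vS'// vn// -vE//; exact/dn.
split=> [[dx d'x]|[dx d'x]].
  split; first exact/dE/dn.
  by rewrite vE -?vn//; [exact/dS'|exact/dn].
have dSn : dom (op_pow S n) (iter n E x) by exact/dE.
split; first exact/dn.
by apply/dS'; rewrite vn -?vE//; exact/dn.
Qed.

(** * Bochner integrals *)

Lemma fsbig_fibers (V : nmodType) (I J : choiceType) (P : set I) (g : I -> J)
    (F : I -> V) : finite_set P ->
  \sum_(j \in g @` P) \sum_(i \in P `&` g @^-1` [set j]) F i =
  \sum_(i \in P) F i.
Proof.
move=> finP; have fingP : finite_set (g @` P) by exact: finite_image.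
under eq_fsbigr do rewrite fsbig_mkcondr.
rewrite exchange_fsbig//; apply: eq_fsbigr => i; rewrite inE => Pi.
rewrite (fsbigD1 (g i))//=; last by exists i.
rewrite ifT ?inE// fsbig1 ?addr0// => j [_ /= jgi].
by rewrite ifF//; apply/negbTE; rewrite notin_setE => /esym.
Qed.

Lemma finite_pair_image (U : Type) (V W : Type) (D : set U) (s : U -> V)
    (s' : U -> W) : finite_set (s @` D) -> finite_set (s' @` D) ->
  finite_set ((fun t => (s t, s' t)) @` D).
Proof.
move=> fs fs'; apply: sub_finite_set (finite_setX fs fs').
by move=> _ [t Dt <-]; split; exists t.
Qed.

(** When q has finitely many values on D this is a finite union, so that
    measurability of the level sets gives that of every preimage. *)
Lemma level_sets_cover (U : Type) (W : choiceType) (D : set U) (q : U -> W)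
    (Q : set W) :
  D `&` q @^-1` Q = \bigcup_(w in q @` D `&` Q) (D `&` q @^-1` [set w]).
Proof.
apply/seteqP; split => [t [Dt Qt]|t [w [_ Qw] [Dt qtw]]].
  by exists (q t) => //; split => //; exists t.
by split => //=; rewrite qtw.
Qed.

Lemma trivIset_level_sets (U : Type) (W : Type) (D : set U) (q : U -> W)
    (P : set W) : trivIset P (fun w => D `&` q @^-1` [set w]).
Proof. by move=> w w' _ _ [t [[_ <-] [_ <-]]]. Qed.

Lemma measurable_fun_simple d d' (U : measurableType d) (V : measurableType d')
    (W : choiceType) (D : set U) (q : U -> W) (g : W -> V) :
  finite_set (q @` D) ->
  (forall w, measurable (D `&` q @^-1` [set w])) ->
  measurable_fun D (g \o q).
Proof.
move=> finq mq _ Z _.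
rewrite comp_preimage level_sets_cover.
apply: fin_bigcup_measurable => //.
exact: finite_setIl.
Qed.

(** The integral may be computed over a finer partition than that of the level
    sets of the integrand: the level sets of q refine those of g o q, and the
    measure is additive. With q a pair of simple functions, this puts both of
    them on a common partition. *)
Lemma simple_integral_comp (R : realType) d (U : measurableType d)
    (mu : {measure set U -> \bar R}) (D : set U) (X : normedModType R[i])
    (W : choiceType) (q : U -> W) (g : W -> X) :
  finite_set (q @` D) ->
  (forall w, measurable (D `&` q @^-1` [set w])) ->
  (forall w, g w != 0 -> (mu (D `&` q @^-1` [set w]) < +oo)%E) ->
  simple_integral mu D (g \o q) =
  \sum_(w \in q @` D) (fine (mu (D `&` q @^-1` [set w])))%:C *: g w.
Proof.
move=> finq mq fing.
rewrite -(fsbig_fibers g)// /simple_integral image_comp.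
apply: eq_fsbigr => y _.
(* The level set of 0 may have infinite measure: its term is treated apart. *)
have [->|y0] := eqVneq y 0.
  rewrite scaler0 fsbig1// => w [_ ->]; exact: scaler0.
have finP : finite_set (q @` D `&` g @^-1` [set y]) by exact: finite_setIl.
rewrite comp_preimage level_sets_cover -fsbig_setU// measure_fsbig//; last first.
  exact: trivIset_level_sets.
have -> : \sum_(w \in q @` D `&` g @^-1` [set y])
      (fine (mu (D `&` q @^-1` [set w])))%:C *: g w =
    \sum_(w \in q @` D `&` g @^-1` [set y])
      (fine (mu (D `&` q @^-1` [set w])))%:C *: y.
  by apply: eq_fsbigr => w; rewrite inE => -[_ ->].
rewrite !fsbig_finite// -scaler_suml -rmorph_sum /= big_seq -sum_fine.
  by rewrite -big_seq.
move=> w; rewrite in_fset_set// inE => -[_ /= gw].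
by rewrite ge0_fin_numE// fing// gw.
Qed.

Lemma integral_simple (R : realType) d (U : measurableType d)
    (mu : {measure set U -> \bar R}) (D : set U)
    (W : choiceType) (q : U -> W) (h : W -> R) :
  finite_set (q @` D) ->
  (forall w, measurable (D `&` q @^-1` [set w])) ->
  (forall w, 0 <= h w) ->
  (forall w, h w != 0 -> (mu (D `&` q @^-1` [set w]) < +oo)%E) ->
  (\int[mu]_(t in D) (h (q t))%:E)%E =
  (\sum_(w \in q @` D) fine (mu (D `&` q @^-1` [set w])) * h w)%:E.
Proof.
move=> finq mq h0 finh.
have DE : D = \big[setU/set0]_(w <- finmap.enum_fset (fset_set (q @` D)))
    (D `&` q @^-1` [set w]).
  rewrite -fsbig_finite// fsbig_setU//.
  by have := level_sets_cover D q setT; rewrite preimage_setT !setIT.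
rewrite {1}DE ge0_integral_bigsetU//; last first.
- by move=> t _; rewrite lee_fin.
- rewrite -DE; apply/measurable_EFinP.
  exact: (measurable_fun_simple h finq mq).
- exact: trivIset_level_sets.
rewrite fsbig_finite// -sumEFin; apply: eq_bigr => w _.
rewrite (eq_integral (fun=> (h w)%:E)); last first.
  by move=> t; rewrite inE => -[_ ->].
rewrite integral_cst//; have [->|hw] := eqVneq (h w) 0.
  by rewrite mul0e mulr0.
by rewrite EFinM fineK ?ge0_fin_numE ?finh// muleC.
Qed.

(** The level sets of the pair are the intersections of those of s and s', so
    all of them have finite measure except possibly that of (0, 0). *)
Lemma integrable_simple_pair (R : realType) d (U : measurableType d)
    (mu : {measure set U -> \bar R}) (D : set U) (X : normedModType R[i])
    (s s' : U -> X) (q := fun t => (s t, s' t)) :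
  integrable_simple mu D s -> integrable_simple mu D s' ->
  [/\ finite_set (q @` D), forall w, measurable (D `&` q @^-1` [set w]) &
    forall w, (w.1 != 0) || (w.2 != 0) ->
      (mu (D `&` q @^-1` [set w]) < +oo)%E].
Proof.
move=> [fs ms] [fs' ms'].
have qE w : D `&` q @^-1` [set w] =
    (D `&` s @^-1` [set w.1]) `&` (D `&` s' @^-1` [set w.2]).
  rewrite setIACA setIid; congr (_ `&` _).
  by apply/seteqP; case: w => a b; split=> t; rewrite /q /= => -[-> ->].
have mq w : measurable (D `&` q @^-1` [set w]).
  by rewrite qE; apply: measurableI; [exact: (ms _).1|exact: (ms' _).1].
split; [exact: finite_pair_image|exact: mq|].
move=> w /orP[w0|w0].
  apply: le_lt_trans ((ms w.1).2 w0); apply: le_measure; rewrite ?inE//.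
    exact: (ms _).1.
  by rewrite qE; exact: subIsetl.
apply: le_lt_trans ((ms' w.2).2 w0); apply: le_measure; rewrite ?inE//.
  exact: (ms' _).1.
by rewrite qE; exact: subIsetr.
Qed.

Lemma measurable_rnormB_simple (R : realType) d (U : measurableType d)
    (mu : {measure set U -> \bar R}) (D : set U) (X : normedModType R[i])
    (s s' : U -> X) :
  integrable_simple mu D s -> integrable_simple mu D s' ->
  measurable_fun D (fun t => rnorm (s t - s' t)).
Proof.
move=> is_s is_s'; have [fq mq _] := integrable_simple_pair is_s is_s'.
exact: (measurable_fun_simple (fun w : X * X => rnorm (w.1 - w.2)) fq mq).
Qed.

Lemma rnorm_sum (R : realType) (X : normedModType R[i]) (I : Type) (r : seq I)
    (F : I -> X) : rnorm (\sum_(i <- r) F i) <= \sum_(i <- r) rnorm (F i).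
Proof.
elim/big_ind2 : _ => //; first by rewrite rnorm0.
by move=> x a y b xa yb; rewrite (le_trans (rnormD _ _))// lerD.
Qed.

(** On the common partition the difference of the integrals is one finite sum,
    to which the triangle inequality applies. *)
Lemma rnorm_simple_integralB (R : realType) d (U : measurableType d)
    (mu : {measure set U -> \bar R}) (D : set U) (X : normedModType R[i])
    (s s' : U -> X) :
  integrable_simple mu D s -> integrable_simple mu D s' ->
  ((rnorm (simple_integral mu D s - simple_integral mu D s'))%:E <=
   \int[mu]_(t in D) (rnorm (s t - s' t))%:E)%E.
Proof.
move=> is_s is_s'; have [fq mq finq] := integrable_simple_pair is_s is_s'.
rewrite (@simple_integral_comp _ _ _ mu D _ _ _ fst fq mq); last first.
  by move=> w w0; apply: finq; rewrite w0.
rewrite (@simple_integral_comp _ _ _ mu D _ _ _ snd fq mq); last first.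
  by move=> w w0; apply: finq; rewrite w0 orbT.
rewrite (@integral_simple _ _ _ mu D _ _ (fun w : X * X => rnorm (w.1 - w.2))
  fq mq); last 2 first.
- by move=> w; exact: rnorm_ge0.
- move=> w; apply: contra_neqT; rewrite ltNge => /negPn muw.
  have /norP[/negPn/eqP -> /negPn/eqP ->] : ~~ ((w.1 != 0) || (w.2 != 0)).
    by apply/negP => /finq; rewrite ltNge muw.
  by rewrite subrr rnorm0.
rewrite lee_fin !fsbig_finite// -sumrB; apply: (le_trans (rnorm_sum _ _)).
apply: ler_sum => w _; rewrite -scalerBr rnormZr// fine_ge0//.
Qed.

(** This is where the pointwise convergence in the definition of the Bochner
    integral is used: the function is a pointwise limit of real simple
    functions. *)
Lemma measurable_rnormB_approx (R : realType) d (U : measurableType d)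
    (mu : {measure set U -> \bar R}) (D : set U) (X : normedModType R[i])
    (f : U -> X) (s : nat -> U -> X) (s' : U -> X) :
  (forall n, integrable_simple mu D (s n)) ->
  (forall t, D t -> (fun n => s n t) @ \oo --> f t) ->
  integrable_simple mu D s' ->
  measurable_fun D (fun t => rnorm (f t - s' t)).
Proof.
move=> is_s sf is_s'.
apply: (@measurable_fun_cvg _ _ _ _ (fun m t => rnorm (s m t - s' t))).
  by move=> m; exact: measurable_rnormB_simple (is_s m) is_s'.
move=> t Dt; have /cvg_rnorm := sf t Dt => /cvgr0Pnorm_lt s0.
apply/cvgrPdist_lt => e e0; apply: filterS (s0 e e0) => m.
apply: le_lt_trans; rewrite [leRHS]ger0_norm ?rnorm_ge0//.
have triangle (a b c : X) : rnorm (a - c) - rnorm (b - c) <= rnorm (a - b).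
  by rewrite lerBlDr (le_trans _ (rnormD _ _))// addrA subrK.
rewrite ler_norml triangle andbT lerNl opprB -(rnormN (f t - s m t)) opprB.
exact: triangle.
Qed.

(** For approximations s and s', the distance between the two simple integrals
    is at most the integral of |s - s'|, hence of |f - s| + |f - s'|, which tends
    to 0. *)
Lemma is_bochner_unique (R : realType) d (U : measurableType d)
    (mu : {measure set U -> \bar R}) (D : set U) (X : normedModType R[i])
    (f : U -> X) (v v' : X) :
  measurable D -> is_bochner mu D f v -> is_bochner mu D f v' -> v = v'.
Proof.
move=> mD [s [is_s sf intf sv]] [s' [is_s' s'f intf' s'v]].
pose I n := simple_integral mu D (s n).
pose I' n := simple_integral mu D (s' n).
have mf n : measurable_fun D (fun t => (rnorm (f t - s n t))%:E).
  by apply/measurable_EFinP; exact: measurable_rnormB_approx is_s sf (is_s n).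
have mf' n : measurable_fun D (fun t => (rnorm (f t - s' n t))%:E).
  by apply/measurable_EFinP; exact: measurable_rnormB_approx is_s sf (is_s' n).
have II' : (fun n => rnorm (I n - I' n)) @ \oo --> (0 : R).
  suff : (fun n => (rnorm (I n - I' n))%:E) @ \oo --> 0%:E.
    by move=> /fine_cvgP[].
  have := cvgeD _ intf intf'; rewrite adde0 => /(_ _ isT) int0.
  apply: (squeeze_cvge _ (@cvg_cst _ _ _ _ _) int0); apply: nearW => n.
  rewrite lee_fin rnorm_ge0/=.
  apply: (le_trans (rnorm_simple_integralB (is_s n) (is_s' n))).
  rewrite -ge0_integralD//; [|by move=> t _; rewrite lee_fin rnorm_ge0..].
  apply: ge0_le_integral => //.
  - by move=> t _; rewrite lee_fin rnorm_ge0.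
  - apply/measurable_EFinP.
    exact: measurable_rnormB_simple (is_s n) (is_s' n).
  - exact: emeasurable_funD.
  move=> t _; rewrite -EFinD lee_fin -(rnormN (f t - s n t)) opprB.
  by rewrite (le_trans _ (rnormD _ _))// addrA subrK.
have v0 := (cvg_rnorm _ _).1 sv; have v'0 := (cvg_rnorm _ _).1 s'v.
have := cvgD (cvgD v0 II') v'0; rewrite !addr0 => /(_ _ _) sum0.
apply/eqP; rewrite -subr_eq0; apply/eqP/rnorm_eq0/eqP.
rewrite eq_le rnorm_ge0 andbT.
have <- := cvg_lim (@Rhausdorff R) sum0.
apply: limr_ge; first exact: cvgP sum0.
apply: nearW => n.
rewrite -[leRHS]/(rnorm (v - I n) + rnorm (I n - I' n) + rnorm (v' - I' n)).
rewrite -(rnormN (v' - I' n)) opprB.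
rewrite (le_trans _ (lerD (rnormD _ _) (lexx _)))// addrA subrK.
by rewrite (le_trans _ (rnormD _ _))// addrA subrK.
Qed.

(** Composing with T turns approximations of f into approximations of T f.
    Bijectivity keeps the level sets unchanged, so that simple integrals
    correspond under T. *)
Lemma is_bochner_isomorphism (R : realType) d (U : measurableType d)
    (mu : {measure set U -> \bar R}) (D : set U) (X Y : normedModType R[i])
    (T : X -> Y) (S : Y -> X) (f : U -> X) (v : X) :
  measurable D -> top_isomorphism T S ->
  is_bochner mu D f v -> is_bochner mu D (T \o f) (T v).
Proof.
move=> mD [lT TS ST [c Tc] _] [s [is_s sf intf sv]].
have T0 := linear_fun0 lT.
have Tcvg (u : nat -> X) l : u @ \oo --> l -> (T \o u) @ \oo --> T l.
  move=> /cvg_rnorm ul; apply/cvg_rnorm.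
  have cul : (fun n => c * rnorm (l - u n)) @ \oo --> (0 : R).
    by rewrite -(mulr0 c); exact: cvgM (cvg_cst c) ul.
  apply: (squeeze_cvgr _ (@cvg_cst _ _ _ _ _) cul); apply: nearW => n /=.
  by rewrite rnorm_ge0 -linear_funB// Tc.
have levelT n y : D `&` (T \o s n) @^-1` [set y] = D `&` s n @^-1` [set S y].
  congr (_ `&` _); apply/seteqP; split=> t /=; first by move=> <-; rewrite TS.
  by move=> ->; rewrite ST.
have is_Ts n : integrable_simple mu D (T \o s n).
  have [fs ms] := is_s n; split.
    by rewrite -image_comp; exact: finite_image.
  move=> y; rewrite levelT; split; first exact: (ms _).1.
  move=> y0; apply: (ms _).2; apply: contra_neq y0 => Sy0.
  by rewrite -(ST y) Sy0 T0.
have Tsf t : D t -> (fun n => T (s n t)) @ \oo --> T (f t).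
  by move=> Dt; exact: Tcvg (sf t Dt).
exists (fun n => T \o s n); split => //.
(* Squeeze between 0 and |c| times the integrals for f; |c| because c is not
   known to be nonnegative. *)
- have mf n : measurable_fun D (fun t => (rnorm (f t - s n t))%:E).
    by apply/measurable_EFinP; exact: measurable_rnormB_approx is_s sf (is_s n).
  have := cvgeZl _ intf; move=> /(_ `|c|%:E isT); rewrite mule0 => cint.
  apply: (squeeze_cvge _ (@cvg_cst _ _ _ _ _) cint); apply: nearW => n.
  rewrite integral_ge0/=; last by move=> t _; rewrite lee_fin rnorm_ge0.
  rewrite -ge0_integralZl//; last by move=> t _; rewrite lee_fin rnorm_ge0.
  apply: ge0_le_integral => //.
  + by move=> t _; rewrite lee_fin rnorm_ge0.
  + apply/measurable_EFinP.
    exact: (measurable_rnormB_approx is_Ts Tsf (is_Ts n)).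
  + exact: measurable_funeM.
  move=> t _; rewrite -EFinM lee_fin -linear_funB// (le_trans (Tc _))//.
  by rewrite ler_wpM2r ?rnorm_ge0 ?ler_norm.
- have -> : (fun n => simple_integral mu D (T \o s n)) =
      T \o (fun n => simple_integral mu D (s n)).
    apply/funext => n; have [fs ms] := is_s n.
    rewrite /= /simple_integral -image_comp fsbig_image; last first.
      by move=> x y _ _ /(can_inj TS).
    rewrite !fsbig_finite// (big_morph T (fun x y => linear_funD x y lT) T0).
    apply: eq_bigr => y _.
    by rewrite linear_funZ// levelT TS.
  exact: Tcvg.
Qed.

Lemma eq_is_bochner (R : realType) d (U : measurableType d)
    (mu : {measure set U -> \bar R}) (D : set U) (X : normedModType R[i])
    (f g : U -> X) (v : X) :
  (forall t, D t -> f t = g t) -> is_bochner mu D f v -> is_bochner mu D g v.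
Proof.
move=> fg [s [is_s sf intf sv]]; exists s; split => //.
  by move=> t Dt; rewrite -fg//; exact: sf.
suff -> : (fun n => \int[mu]_(t in D) (rnorm (g t - s n t))%:E)%E =
  (fun n => \int[mu]_(t in D) (rnorm (f t - s n t))%:E)%E by [].
by apply/funext => n; apply: eq_integral => t; rewrite inE => Dt; rewrite fg.
Qed.

(** By uniqueness the chosen values correspond under T; if f is not integrable,
    then neither is g, as T is invertible, and both sides are the default 0. *)
Lemma bochner_isomorphism (R : realType) d (U : measurableType d)
    (mu : {measure set U -> \bar R}) (D : set U) (X Y : normedModType R[i])
    (T : X -> Y) (S : Y -> X) (f : U -> X) (g : U -> Y) :
  measurable D -> top_isomorphism T S -> (forall t, D t -> g t = T (f t)) ->
  bochner mu D g = T (bochner mu D f).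
Proof.
move=> mD TS gE; have [lT _ ST _ _] := TS.
have push v : is_bochner mu D f v -> is_bochner mu D g (T v).
  move=> /(is_bochner_isomorphism mD TS); apply: eq_is_bochner => t Dt.
  by rewrite gE.
have pull v : is_bochner mu D g v -> is_bochner mu D f (S v).
  have ST' := top_isomorphism_sym TS; have [_ _ TK _ _] := ST'.
  move=> /(is_bochner_isomorphism mD ST'); apply: eq_is_bochner => t Dt /=.
  by rewrite gE// TK.
have [[v fv]|nof] := pselect (exists v, is_bochner mu D f v).
  rewrite /bochner (xget_unique _ fv); last first.
    by move=> w fw; exact: is_bochner_unique mD fw fv.
  apply: xget_unique; first exact: push.
  by move=> w gw; apply: is_bochner_unique mD gw (push _ fv).
rewrite /bochner xgetPN => [|w /pull gw]; last by apply: nof; exists (S w).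
rewrite xgetPN => [|w fw]; last by apply: nof; exists w.
by rewrite linear_fun0.
Qed.

(** * The Balakrishnan operator and fractional powers *)

Lemma dom_op_pow_total (X : Type) (S : operator X X) (n : nat) (x : X) :
  (forall y, dom S y) -> dom (op_pow S n) x.
Proof. by move=> dS; elim: n => [//|n IH] /=; split. Qed.

(** Pointwise in l, the integrands correspond under T because they are powers of
    an operator composed from A and its resolvent. Only l > 0 matters, where the
    resolvent exists and is defined everywhere. *)
Lemma balakrishnan_intertwines (R : realType) (X Y : normedModType R[i])
    (A : operator X X) (B : operator Y Y) (T : X -> Y) (S : Y -> X)
    (alpha : R[i]) (n : nat) :
  linear_operator A ->
  (forall l : R, 0 < l -> boundedly_invertible (op_shift l%:C A)) ->
  top_isomorphism T S -> intertwines T A B ->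
  intertwines T (balakrishnan A alpha n) (balakrishnan B alpha n).
Proof.
move=> lA lpos TS AB; have [lT TK ST _ _] := TS.
move=> x; split => [|_ /=]; first exact: (intertwines_pow n AB x).1.
rewrite linear_funZ//; congr (_ *: _).
apply: (@bochner_isomorphism R _ _ lebesgue_measure `]0%R, +oo[ X Y T S) => //.
move=> l; rewrite /= in_itv/= andbT => l0.
have lA_inv := lpos l l0; have [[_ Ainj _] _] := lA_inv.
have bT : bijective T by exists S.
have Aint := intertwines_inv bT Ainj (intertwines_shift l%:C lT AB).
rewrite linear_funZ//; congr (_ *: _).
apply: (intertwines_pow n (intertwines_comp AB Aint) x).2.
have [dG _ _ _ _] := resolventP lA lA_inv.
apply: dom_op_pow_total => y; split; last exact: dG.
by have [[_ _ surj] _] := lA_inv; exact: surj.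
Qed.

Lemma intertwines_iter (X : Type) (E : X -> X) (A : operator X X) (n : nat) :
  intertwines E A A -> intertwines (iter n E) A A.
Proof.
move=> EA; elim: n => [//|n IH] x /=; have [dn vn] := IH x.
have [dE vE] := EA (iter n E x).
by split=> [|dx]; [rewrite dn|rewrite vE ?vn//; exact/dn].
Qed.

Lemma intertwines_opeq (X Y : Type) (T : X -> Y) (A A' : operator X X)
    (B : operator Y Y) :
  A =op A' -> intertwines T A B -> intertwines T A' B.
Proof.
move=> [dA vA] AB x; have [dx vx] := AB x; rewrite -dA.
by split => // Ax; rewrite vx// vA.
Qed.

(** F slides through J in P' J Q' = P' J F Q = P' F J Q = P J Q. *)
Lemma op_comp_insert (X : Type) (F : X -> X)
    (J P P' Q Q' : operator X X) :
  intertwines F J J -> (forall x, dom Q x) -> (forall x, dom Q' x) ->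
  (forall x, Q' x = F (Q x)) ->
  (forall x, (dom P x <-> dom P' (F x)) /\ (dom P x -> P x = P' (F x))) ->
  op_comp P (op_comp J Q) =op op_comp P' (op_comp J Q').
Proof.
move=> FJ dQ dQ' QF PF; split=> [|x [[_ dJ] dJx] /=]; last first.
  by rewrite QF (FJ _).2// (PF _).2.
apply/seteqP; split=> x /= [[_ dJ] dJx].
  rewrite QF (FJ _).2//; split; last exact/(PF _).1.
  by split; [exact: dQ'|exact: (FJ (Q x)).1.1].
move: dJ dJx; rewrite QF => /(FJ (Q x)).1.2 dJ; rewrite (FJ _).2// => /(PF _).1.
by split.
Qed.

(** With E = (A + w)(A + z)^-1 and F = E^n, the resolvents satisfy
    (A + z)^-n = F (A + w)^-n, the shifts satisfy (A + w)^n = (A + z)^n F, and F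
    commutes with the Balakrishnan operator. *)
Lemma frac_power_shift_indep (R : realType) (X : normedModType R[i])
    (A : operator X X) (alpha z w : R[i]) (n : nat) :
  linear_operator A ->
  (forall l : R, 0 < l -> boundedly_invertible (op_shift l%:C A)) ->
  boundedly_invertible (op_shift z A) ->
  boundedly_invertible (op_shift w A) ->
  frac_power A alpha n w =op frac_power A alpha n z.
Proof.
move=> lA lpos zA wA.
pose E := shift_change A z w.
have EA : intertwines E A A := shift_change_intertwines w lA zA.
have isoE : top_isomorphism E (shift_change A w z).
  exact: shift_change_isomorphism.
have [linE EK KE _ _] := isoE.
have bE : bijective E by exists (shift_change A w z).
have [S' isoEn] := top_isomorphism_iter n isoE.
have EnA := intertwines_iter n EA.
have EnJ := balakrishnan_intertwines alpha n lA lpos isoEn EnA.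
have [[_ winj wsurj] _] := wA; have [[_ _ zsurj] _] := zA.
have domR u : boundedly_invertible (op_shift u A) ->
    forall x, dom (op_pow (op_inv (op_shift u A)) n) x.
  by move=> [[_ _ surj] _] x; apply: dom_op_pow_total => y; exact: surj.
have RE x : op_pow (op_inv (op_shift z A)) n x =
    op_pow (op_inv (op_shift w A)) n (iter n E x).
  have ERw := intertwines_inv bE winj (intertwines_shift w linE EA).
  apply: (op_pow_translate n ERw _ _ x).2; last exact: domR.
    by move=> y; split=> _; [exact: wsurj|exact: zsurj].
  by move=> y _; rewrite op_inv_shift_change.
have RwE x : op_pow (op_inv (op_shift w A)) n (iter n E x) =
    iter n E (op_pow (op_inv (op_shift w A)) n x).
  have EnRw : intertwines (iter n E)
      (op_inv (op_shift w A)) (op_inv (op_shift w A)).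
    have [linEn EnK KEn _ _] := isoEn.
    by apply: intertwines_inv => //; [exists S'|exact: intertwines_shift].
  by apply: (intertwines_pow n EnRw x).2; exact: domR.
have zE := @op_pow_translate _ E (op_shift z A) (op_shift w A) n
  (intertwines_shift z linE EA) (fun y => (EA y).1)
  (fun y dy => esym (op_shift_shift_change w lA zA dy)).
apply: (op_comp_insert (F := iter n E)) => //; [exact: domR|exact: domR|].
by move=> x; rewrite RE RwE.
Qed.

Lemma frac_power_intertwines (R : realType) (X Y : normedModType R[i])
    (A : operator X X) (B : operator Y Y) (T : X -> Y) (S : Y -> X)
    (alpha w : R[i]) (n : nat) :
  linear_operator A ->
  (forall l : R, 0 < l -> boundedly_invertible (op_shift l%:C A)) ->
  boundedly_invertible (op_shift w A) ->
  top_isomorphism T S -> intertwines T A B ->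
  intertwines T (frac_power A alpha n w) (frac_power B alpha n w).
Proof.
move=> lA lpos [[_ winj _] _] TS AB; have [lT TK ST _ _] := TS.
have wAB := intertwines_shift w lT AB.
apply: intertwines_comp; first exact: intertwines_pow.
apply: intertwines_comp; first exact: balakrishnan_intertwines lpos TS AB.
by apply: intertwines_pow; apply: intertwines_inv => //; exists S.
Qed.

Lemma op_oppK (R : realType) (X : normedModType R[i]) (A : operator X X) :
  op_opp (op_opp A) = A.
Proof.
by case: A => D f; congr Operator; apply/funext => x /=; rewrite opprK.
Qed.

Theorem proposition10 (R : realType) (X Y : completeNormedModType R[i])
    (A : operator X X) (B : operator Y Y) (T : X -> Y)
    (linA : linear_operator A) (linB : linear_operator B)
    (nnA : nonnegative_operator A) (nnB : nonnegative_operator B)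
    (simAB : similar_via T A B)
    (alpha : R[i]) (alpha_gt0 : 0 < complex.Re alpha)
    (n : nat) (n_gt : complex.Re alpha < n%:R) :
  balakrishnan B alpha n =op op_conj T (balakrishnan A alpha n) /\
  (forall z w : R[i],
     resolvent_set (op_opp A) z -> resolvent_set (op_opp B) w ->
     frac_power B alpha n w =op op_conj T (frac_power A alpha n z)).
Proof.
have [isoT BTA] := simAB; have [linT bijT normT] := isoT.
have [S TS ST] := bijT; have [lposA _] := nnA.
have TSiso : top_isomorphism T S.
  split => //; exists 1 => x; rewrite mul1r ?normT//.
  by rewrite -normT ST.
have AB : intertwines T A B by exact/intertwines_opeq_conj.
split.
  apply/intertwines_opeq_conj => //.
  exact: balakrishnan_intertwines TSiso AB.
move=> z w; rewrite /resolvent_set /= !op_oppK => zA wB.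
have wAB := intertwines_shift w linT AB.
have wA := intertwines_boundedly_invertible isoT wAB wB.
apply/intertwines_opeq_conj => //.
apply: (intertwines_opeq (frac_power_shift_indep alpha n linA lposA zA wA)).
exact: frac_power_intertwines lposA wA TSiso AB.
Qed.
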